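(* Let $B$ be a band that is left seminormal or right seminormal. Then all maximal subgroups of the free idempotent generated semigroup $\mathsf{IG}(B)$ are free groups.
   Context: A band is a semigroup $B$ in which every element is idempotent ($x^2=x$ for all $x\in B$). A band is right seminormal if it satisfies the identity $tuv=tvtuv$; it is left seminormal if it satisfies the left-right dual identity $vut=vutvt$. For a semigroup $S$ with set of idempotents $E=E(S)$, a pair of idempotents $e,f\in E$ (with $e=f$ allowed) is a basic pair if $\{ef,fe\}\cap\{e,f\}\neq\varnothing$ (products in $S$); in that case both $ef$ and $fe$ are idempotents of $S$. The free idempotent generated semigroup over $E$ is the semigroup given by the presentation $$\mathsf{IG}(E)=\langle E \mid e\cdot f=ef \text{ for all } e,f\in E \text{ such that } \{e,f\} \text{ is a basic pair}\rangle,$$ where $\cdot$ is concatenation in the free semigroup $E^+$ and $ef$ denotes the product of $e$ and $f$ in $S$, viewed as a single generator. For a band $B$ we have $E(B)=B$, and $\mathsf{IG}(B)$ denotes $\mathsf{IG}(E(B))$. The maximal subgroups of a semigroup are its subgroups that are maximal under inclusion, i.e. its $\mathcal{H}$-classes that contain an idempotent. The trivial group counts as a free group (of rank $0$). *)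

(* Defs.v *)
From HB Require Import structures.
From mathcomp Require Import all_boot.
From mathcomp Require Import boolp classical_sets.

Set Implicit Arguments.
Unset Strict Implicit.
Unset Printing Implicit Defensive.

Local Open Scope classical_set_scope.
Local Open Scope quotient_scope.
Local Open Scope group_scope.

Inductive cong_gen (T : semigroupType) (R : T -> T -> Prop) : T -> T -> Prop :=
| cong_gen_base x y : R x y -> cong_gen R x y
| cong_gen_refl x : cong_gen R x x
| cong_gen_sym x y : cong_gen R x y -> cong_gen R y x
| cong_gen_trans y x z : cong_gen R x y -> cong_gen R y z -> cong_gen R x z
| cong_gen_mul x x' y y' :
    cong_gen R x x' -> cong_gen R y y' -> cong_gen R (x * y) (x' * y').

Definition congb (T : semigroupType) (R : T -> T -> Prop) : rel T :=
  fun x y => `[< cong_gen R x y >].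

Lemma congb_equiv (T : semigroupType) (R : T -> T -> Prop) :
  equiv_class_of (congb R).
Proof.
split=> [x|x y|y x z].
- exact/asboolP/cong_gen_refl.
- by apply/asboolP/asboolP; exact: cong_gen_sym.
- by move=> /asboolP xy /asboolP yz; apply/asboolP/(cong_gen_trans xy).
Qed.

Canonical congb_equiv_rel (T : semigroupType) (R : T -> T -> Prop) :=
  EquivRelPack (congb_equiv R).

Definition presented (T : semigroupType) (R : T -> T -> Prop) : Type :=
  {eq_quot (congb R)}.

HB.instance Definition _ (T : semigroupType) (R : T -> T -> Prop) :=
  Choice.on (presented R).
HB.instance Definition _ (T : semigroupType) (R : T -> T -> Prop) :=
  EqQuotient.on (presented R).

Section PresentedSemigroup.
Variables (T : semigroupType) (R : T -> T -> Prop).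

Definition presented_pi (x : T) : presented R := \pi x.

Definition presented_mul (a b : presented R) : presented R :=
  presented_pi (repr a * repr b).

Lemma presented_piP (x y : T) :
  presented_pi x = presented_pi y <-> cong_gen R x y.
Proof.
by split=> [/eqmodP /asboolP|xy] //; apply/eqmodP/asboolP.
Qed.

Lemma presented_piK (a : presented R) : presented_pi (repr a) = a.
Proof. exact: reprK. Qed.

Lemma presented_piM (x y : T) :
  presented_mul (presented_pi x) (presented_pi y) = presented_pi (x * y).
Proof.
by apply/presented_piP; apply: cong_gen_mul;
   apply/presented_piP; rewrite presented_piK.
Qed.

Lemma presented_mulA : associative presented_mul.
Proof.
move=> a b c; rewrite -[a]presented_piK -[b]presented_piK -[c]presented_piK.
by rewrite !presented_piM mulgA.
Qed.

HB.instance Definition _ := isSemigroup.Build (presented R) presented_mulA.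

End PresentedSemigroup.

Definition free_semigroup (A : choiceType) : Type :=
  {w : seq A | w != [::]}.

HB.instance Definition _ (A : choiceType) := Choice.on (free_semigroup A).

Section FreeSemigroup.
Variable A : choiceType.

Definition fs_gen (a : A) : free_semigroup A :=
  exist (fun w : seq A => w != [::]) [:: a] isT.

Lemma fs_cat_subproof (u v : free_semigroup A) : val u ++ val v != [::].
Proof. by case: u => -[|a u]. Qed.

Definition fs_cat (u v : free_semigroup A) : free_semigroup A :=
  exist (fun w : seq A => w != [::]) (val u ++ val v) (fs_cat_subproof u v).

Lemma fs_catA : associative fs_cat.
Proof. by move=> u v w; apply: val_inj; rewrite /= catA. Qed.

HB.instance Definition _ := isSemigroup.Build (free_semigroup A) fs_catA.

End FreeSemigroup.

(* A letter (x, true) stands for the generator x, (x, false) for its inverse. *)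
Definition signed_word (X : choiceType) : Type := seq (X * bool).

HB.instance Definition _ (X : choiceType) := Choice.on (signed_word X).
HB.instance Definition _ (X : choiceType) :=
  isMonoid.Build (signed_word X) (@catA _) (@cat0s _) (@cats0 _).

Definition cancel_letters (X : choiceType) (u v : signed_word X) : Prop :=
  exists (x : X) (b : bool), u = [:: (x, b); (x, ~~ b)] /\ v = [::].

Definition free_group (X : choiceType) : Type :=
  presented (@cancel_letters X).

HB.instance Definition _ (X : choiceType) := Semigroup.on (free_group X).

Section FreeGroup.
Variable X : choiceType.

Definition sw_inv (w : signed_word X) : signed_word X :=
  rev [seq (a.1, ~~ a.2) | a <- w].

Lemma sw_invM (u v : signed_word X) : sw_inv (u * v) = sw_inv v * sw_inv u.
Proof. by rewrite /sw_inv map_cat rev_cat. Qed.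

Lemma sw_invK : involutive sw_inv.
Proof.
move=> w; rewrite /sw_inv map_rev revK -map_comp map_id_in //.
by move=> [x b] _ /=; rewrite negbK.
Qed.

Lemma sw_mulVw (w : signed_word X) :
  cong_gen (@cancel_letters X) (sw_inv w * w) 1.
Proof.
elim: w => [|[x b] w IHw]; first exact: cong_gen_refl.
pose c : signed_word X := [:: (x, ~~ b); (x, b)].
have -> : sw_inv ((x, b) :: w) * ((x, b) :: w : signed_word X)
  = sw_inv w * (c * w).
  by rewrite /sw_inv /= rev_cons -cats1 -[LHS]catA.
apply: cong_gen_trans IHw; apply: cong_gen_mul; first exact: cong_gen_refl.
rewrite -(mul1g (w : signed_word X)) mulgA.
apply: cong_gen_mul; last exact: cong_gen_refl.
rewrite mulg1.
by apply: cong_gen_base; exists x, (~~ b); rewrite negbK.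
Qed.

Lemma sw_inv_cong (u v : signed_word X) :
  cong_gen (@cancel_letters X) u v ->
  cong_gen (@cancel_letters X) (sw_inv u) (sw_inv v).
Proof.
elim=> {u v}.
- move=> u v [x [b [-> ->]]]; apply: cong_gen_base; exists x, b.
  by rewrite /sw_inv /= negbK.
- by move=> u; apply: cong_gen_refl.
- by move=> u v _; apply: cong_gen_sym.
- by move=> v u w _ + _; apply: cong_gen_trans.
- by move=> u u' v v' _ IHu _ IHv; rewrite !sw_invM; apply: cong_gen_mul.
Qed.

Definition fg_one : free_group X := presented_pi _ (1 : signed_word X).
Definition fg_inv (a : free_group X) : free_group X :=
  presented_pi _ (sw_inv (repr (a : presented (@cancel_letters X)))).

Lemma fg_mul1g : left_id fg_one *%g.
Proof.
by move=> a; rewrite -[a]presented_piK [LHS]presented_piM mul1g.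
Qed.

Lemma fg_mulg1 : right_id fg_one *%g.
Proof.
by move=> a; rewrite -[a]presented_piK [LHS]presented_piM mulg1.
Qed.

Lemma fg_mulVg : left_inverse fg_one fg_inv *%g.
Proof.
move=> a; rewrite -[Z in _ * Z]presented_piK [LHS]presented_piM.
exact/presented_piP/sw_mulVw.
Qed.

Lemma fg_mulgV : right_inverse fg_one fg_inv *%g.
Proof.
move=> a; rewrite -[Z in Z * _]presented_piK [LHS]presented_piM.
apply/presented_piP; rewrite -{1}[repr _]sw_invK; exact: sw_mulVw.
Qed.

HB.instance Definition _ :=
  isGroup.Build (free_group X) (@mulgA (free_group X))
    fg_mul1g fg_mulg1 fg_mulVg fg_mulgV.

End FreeGroup.

Definition is_subgroup (S : semigroupType) (G : set S) : Prop :=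
  (forall x y, G x -> G y -> G (x * y)) /\
  exists2 e, G e &
    forall x, G x ->
      e * x = x /\ x * e = x /\ exists2 y, G y & x * y = e /\ y * x = e.

Definition is_maximal_subgroup (S : semigroupType) (G : set S) : Prop :=
  is_subgroup G /\ forall H : set S, is_subgroup H -> G `<=` H -> H = G.

(* The subset G, under the multiplication of S, is isomorphic to a free group
   on some set X; X may be empty, so the trivial group qualifies. *)
Definition is_free_group (S : semigroupType) (G : set S) : Prop :=
  exists (X : choiceType) (phi : {multiplicative free_group X -> S}),
    injective phi /\ range phi = G.

Definition is_band (B : semigroupType) : Prop := forall x : B, x * x = x.

Definition right_seminormal (B : semigroupType) : Prop :=
  forall t u v : B, t * u * v = t * v * t * u * v.

Definition left_seminormal (B : semigroupType) : Prop :=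
  forall t u v : B, v * u * t = v * u * t * v * t.

Definition idempotents (S : semigroupType) : Type := {e : S | e * e == e}.

HB.instance Definition _ (S : semigroupType) := Choice.on (idempotents S).

Definition basic_pair (S : semigroupType) (e f : S) : Prop :=
  [set e * f; f * e] `&` [set e; f] !=set0.

(* For a basic pair (e, f) the product ef of S is again an idempotent; it is
   the generator g below. *)
Definition IG_rel (S : semigroupType)
    (u v : free_semigroup (idempotents S)) : Prop :=
  exists e f g : idempotents S,
    [/\ basic_pair (val e) (val f), val g = val e * val f,
        u = fs_gen e * fs_gen f & v = fs_gen g].

Definition IG (S : semigroupType) : Type := presented (@IG_rel S).

HB.instance Definition _ (S : semigroupType) := Semigroup.on (IG S).

(* Main.v *)
Require Import Defs.
From HB Require Import structures.
From mathcomp Require Import all_boot.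
From mathcomp Require Import boolp classical_sets.
From Stdlib Require Import Relation_Operators.

Set Implicit Arguments.
Unset Strict Implicit.
Unset Printing Implicit Defensive.

Local Open Scope group_scope.

(** Every maximal subgroup G of IG(B) has an identity f. Writing [b] for the
    generator of IG(B) given by b, some letter e of any word for f lies
    J-below all the other letters ([idempotent_bottom]). Since
    [x][b] = [x][bxb] whenever x is J-below b ([genM_conjr]), all words around
    G can be rewritten with letters from the D-class of e only.

    That D-class is a rectangular band: its elements are the products ij with
    i in the L-class and j in the R-class of e, and the part of IG(B) that it
    generates is a completely simple semigroup, that is, a Rees matrix
    semigroup with elements [i] h [j] and with sandwich entries [j][i]. Its
    structure group is generated by these entries, where [e][i] and [j][e] are
    the identity. Any further relations come from the elements b above e, by
    way of singular squares. In a right seminormal band, such a b acts on the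
    left of the L-class of e as a constant map ([inL_act]). What remains of the
    singular square relations then says only that [j][i] = [l][i] for all i as
    soon as some b above e fixes both j and l on the right
    ([linked_sandwich]). Thus the relations merely identify generators with one
    another or with the identity, and the group is free on the pairs
    (connected component of columns other than that of e, i <> e).

    The two halves of this claim are proved as follows. The normal forms
    [i] h [j] show that G is covered by the image of
    the free group ([normal_form]). The right action of IG(B) on an R-class of the
    Rees matrix semigroup over that free group ([rees_act]) shows that nothing
    collapses ([fg_eval_inj]); this is where one checks that the defining
    relations of IG(B) hold. Left seminormal bands follow by passing to opposite
    semigroups, for which the argument is phrased for any semigroup that has
    the universal property of IG(B). *)

(** * The J-order of a band *)

Definition jle (B : semigroupType) (a b : B) : bool := a * b * a == a.

Section Band.
Variable B : semigroupType.
Hypothesis hB : is_band B.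
Implicit Types a b c x y u : B.

(** Since [u] ends with [b y], it absorbs [b y] on the right, so
    [u b u = u b (u b y) = (u b) y = u]. *)
Lemma jle_factor x b y u : u = x * b * y -> jle u b.
Proof.
move=> eu; apply/eqP.
have uu : u * u = u by exact: hB.
have uby : u * b * y = u.
  rewrite {1}eu -!mulgA (mulgA b y (b * y)) (hB (b * y) : _ = _).
  by rewrite eu mulgA.
rewrite -{2}uby (_ : _ * _ = u * b * (u * b) * y); last by rewrite !mulgA.
by rewrite hB.
Qed.

Lemma jle_refl a : jle a a.
Proof. by rewrite /jle !hB. Qed.

Lemma jle_trans b a c : jle a b -> jle b c -> jle a c.
Proof.
move=> /eqP ab /eqP bc; apply: (@jle_factor (a * b) _ (b * a)).
by rewrite !mulgA -(mulgA a b c) -(mulgA a (b * c)) bc ab.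
Qed.

Lemma jle_mull a b : jle (a * b) a.
Proof. by apply: (@jle_factor a _ b); rewrite hB. Qed.

Lemma jle_mulr a b : jle (a * b) b.
Proof. by apply: (@jle_factor a _ b); rewrite -mulgA hB. Qed.

(** From right to left: [x = (x b x) (x a x)] contains [b x a], whose square
    contains [a b], so that [jle_factor] applies. *)
Lemma jle_mul x a b : jle x (a * b) = jle x a && jle x b.
Proof.
apply/idP/andP=> [xab|[/eqP xa /eqP xb]].
  by split; apply: jle_trans xab _; rewrite ?jle_mull ?jle_mulr.
apply: (@jle_factor (x * b * x) _ (x * a * x)).
have: b * x * a * (b * x * a) = b * x * a by exact: hB.
rewrite !mulgA => bxa.
rewrite -!mulgA.
have -> : x * (b * (x * (a * (b * (x * (a * x)))))) =
          x * (b * x * a * b * x * a) * x by rewrite !mulgA.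
by rewrite bxa !mulgA xb xa.
Qed.

(** The factors of a basic pair are J-comparable, and their product is
    J-equivalent to the lower one. *)
Lemma basic_pair_jle a b :
  basic_pair a b -> jle a b /\ jle (a * b) a && jle a (a * b)
                 \/ jle b a /\ jle (a * b) b && jle b (a * b).
Proof.
have E x y : jle x y -> jle (x * y) x && jle x (x * y).
  by move=> xy; rewrite jle_mull jle_mul jle_refl.
have F x y : jle y x -> jle (x * y) y && jle y (x * y).
  by move=> xy; rewrite jle_mulr jle_mul jle_refl xy.
case=> _ [[->|->] [eq|eq]].
- by left; rewrite E /jle ?eq ?hB //.
- by right; rewrite F // /jle -mulgA eq hB.
- by left; rewrite E // /jle -mulgA eq hB.
- by right; rewrite F // /jle eq hB.
Qed.

End Band.
(** * The universal property of IG(B) *)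

(** The universal property is stated for monoids given by bare operations and
    induction over products of arbitrary shape, so that the record is visibly
    invariant under reversing both multiplications. *)
Record idempotent_presentation (B S : semigroupType) (gen : B -> S) : Prop := {
  ip_basic : forall a b, basic_pair a b -> gen a * gen b = gen (a * b);
  ip_ind : forall P : S -> Prop, (forall a, P (gen a)) ->
    (forall s t, P s -> P t -> P (s * t)) -> forall s, P s;
  ip_lift : forall (T : Type) (mul : T -> T -> T) (one : T) (f : B -> T),
    associative mul -> left_id one mul -> right_id one mul ->
    (forall a b, basic_pair a b -> mul (f a) (f b) = f (a * b)) ->
    exists2 F : S -> T, (forall a, F (gen a) = f a) &
                        forall s t, F (s * t) = mul (F s) (F t)
}.

Section IGPresentation.
Variable B : semigroupType.
Hypothesis hB : is_band B.

Definition band_idem (b : B) : idempotents B :=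
  exist (fun e : B => e * e == e) b (introT eqP (hB b)).

Definition IG_gen (b : B) : IG B :=
  presented_pi (@IG_rel B) (fs_gen (band_idem b)).

Lemma IG_presentation : idempotent_presentation IG_gen.
Proof.
split.
- move=> a b ab; rewrite [LHS]presented_piM; apply/presented_piP.
  apply: cong_gen_base.
  by exists (band_idem a), (band_idem b), (band_idem (a * b)).
- move=> P Pgen Pmul s; rewrite -(presented_piK s).
  case: (repr _) => w; case: w => // a w wn.
  elim: w a wn => [|b w IHw] a wn.
    rewrite (_ : exist _ _ _ = fs_gen (band_idem (val a))); first exact: Pgen.
    by apply: val_inj => /=; congr [:: _]; apply: val_inj.
  rewrite (_ : exist _ _ _ =
      fs_gen (band_idem (val a)) * exist _ (b :: w) isT); last first.
    by apply: val_inj => /=; congr (_ :: _); apply: val_inj.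
  by rewrite -presented_piM; apply: Pmul; [exact: Pgen | exact: IHw].
- move=> T mul one f mulA mul1 mulr1 fbasic.
  pose F (w : seq (idempotents B)) := foldr (fun a t => mul (f (val a)) t) one w.
  have FM u v : F (u ++ v) = mul (F u) (F v).
    by elim: u => [|a u IHu] /=; rewrite ?mul1 // -mulA -IHu.
  have Fcong (u v : free_semigroup (idempotents B)) :
      cong_gen (@IG_rel B) u v -> F (val u) = F (val v).
    elim=> {u v} //.
    + move=> u v [e [g [h [eg he -> ->]]]].
      by rewrite /= !mulr1 fbasic // he.
    + by move=> u v w _ -> _ ->.
    + by move=> u u' v v' _ Hu _ Hv; rewrite !FM Hu Hv.
  exists (fun s : IG B => F (val (repr (s : presented (@IG_rel B))))).
    move=> a; rewrite -[RHS]mulr1.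
    rewrite (Fcong _ (fs_gen (band_idem a))) //.
    by apply/presented_piP; rewrite presented_piK.
  move=> s t; rewrite -FM.
  apply: (Fcong _ (_ * _)); apply/presented_piP.
  by rewrite -presented_piM !presented_piK.
Qed.

End IGPresentation.

Section Idempotents.
Variables (B S : semigroupType) (gen : B -> S).
Hypothesis hB : is_band B.
Hypothesis hS : idempotent_presentation gen.

Lemma ip_word s : exists a w, s = foldl (fun t b => t * gen b) (gen a) w.
Proof.
elim/(ip_ind hS): s => [a|_ _ [a [u ->]] [b [v ->]]]; first by exists a, [::].
exists a, (u ++ b :: v); rewrite foldl_cat /=.
move: (foldl _ _ u) => s; elim/last_ind: v => [|v c IHv] //.
by rewrite -cats1 !foldl_cat /= mulgA IHv.
Qed.

Lemma jle_minimal (a : B) w :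
  exists2 d, d \in a :: w & forall c, c \in a :: w -> jle c d -> jle d c.
Proof.
elim: w a => [|b w IHw] a.
  by exists a => [|c]; rewrite ?mem_head // inE => /eqP->.
have [d dw dmin] := IHw b.
case: (boolP (jle a d)) => [ad|nad].
  exists a => [|c]; rewrite ?mem_head // inE => /predU1P[->//|cw ca].
  exact: (jle_trans hB ad (dmin _ cw (jle_trans hB ca ad))).
exists d => [|c]; first by rewrite inE dw orbT.
by rewrite inE => /predU1P[->|]; [rewrite (negPf nad) | exact: dmin].
Qed.

(** An automaton that separates idempotents from longer words. Relative to a
    letter [d], a letter equivalent to [d] counts as [true], a letter
    incomparable with [d] as [false], and a letter strictly above [d] is
    invisible. The state holds the last visible kind and the number of changes
    of kind so far. A letter strictly below [d] kills the run: otherwise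
    rewriting could swallow incomparable letters, and the count would not
    respect the relations. *)
Definition alternate (d : B) (st : option (nat * bool)) (c : B) :=
  if st is Some (n, q) then
    let tick b := if q == b then Some (n, q) else Some (n.+1, b) in
    if jle c d then if jle d c then tick true else None
    else if jle d c then Some (n, q) else tick false
  else None.

(** In a basic pair the lower letter absorbs the upper one, and so it does for
    the automaton: a letter above a visible one is invisible or of the same
    kind, and a letter above an invisible one is invisible. *)
Lemma alternate_basic d st a b :
  basic_pair a b -> alternate d (alternate d st a) b = alternate d st (a * b).
Proof.
have E x y : jle x y && jle y x -> alternate d st x = alternate d st y.
  move=> /andP[xy yx]; rewrite /alternate.
  have -> : jle x d = jle y d by apply/idP/idP; exact: (jle_trans hB).
  suff -> : jle d x = jle d y by [].
  by apply/idP/idP => /(jle_trans hB); apply.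
have absorb x y : jle x y ->
    alternate d (alternate d st x) y = alternate d st x /\
    alternate d (alternate d st y) x = alternate d st x.
  move=> xy; have : jle d x ==> jle d y.
    by apply/implyP => /(jle_trans hB); apply.
  have : jle y d ==> jle x d by apply/implyP; exact: (jle_trans hB).
  rewrite /alternate.
  by case: (jle x d) (jle d x) (jle y d) (jle d y) st {E} =>
    [] [] [] [] [[n []]|].
by case/(basic_pair_jle hB) => -[/absorb[xy yx] /E ->].
Qed.

(** If a run adds no change of kind, then all visible letters read are of the
    kind with which it started. A letter [c] is visible exactly when
    [jle c d = jle d c], and this common value is then its kind. *)
Lemma alternate_run d n q w :
    (forall c, c \in w -> jle c d -> jle d c) ->
  exists m q', [/\ foldl (alternate d) (Some (n, q)) w = Some (m, q'), n <= m &
    m = n -> q' = q /\ forall c, c \in w -> jle c d = jle d c -> q = jle c d].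
Proof.
elim: w n q => [|c w IHw] n q dmin; first by exists n, q; split.
have cd := dmin c (mem_head _ _).
have dminw x : x \in w -> jle x d -> jle d x.
  by move=> xw; apply: dmin; rewrite inE xw orbT.
have [qc|] := boolP ((jle c d == jle d c) ==> (q == jle c d)).
  have [m [q' [run nm same]]] := IHw n q dminw; exists m, q'.
  rewrite -[foldl _ _ _]/(foldl _ (alternate d (Some (n, q)) c) w).
  have -> : alternate d (Some (n, q)) c = Some (n, q).
    rewrite /=; move: cd qc.
    by case: (jle c d) (jle d c) q {IHw run same} => [] [] [] //= /(_ isT).
  split=> // /same[-> sq]; split=> // x; rewrite inE => /predU1P[-> ecd|].
    by apply/eqP; move: qc; rewrite ecd eqxx.
  exact: sq.
rewrite negb_imply => /andP[/eqP ec qn].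
have step : alternate d (Some (n, q)) c = Some (n.+1, ~~ q).
  by rewrite /= -ec; case: (jle c d) q qn => [] [].
have [m [q' [run nm same]]] := IHw n.+1 (~~ q) dminw; exists m, q'.
rewrite -[foldl _ _ _]/(foldl _ (alternate d (Some (n, q)) c) w) step.
by split=> //; [exact: ltnW | move=> mn; rewrite mn ltnn in nm].
Qed.

(** Take [d] minimal among the letters. Reading the word twice must have the
    same effect as reading it once, so the second reading adds no change of
    kind; as [d] itself is visible, no letter is incomparable with [d]. *)
Lemma idempotent_bottom s : s * s = s ->
  exists a w d, [/\ s = foldl (fun t b => t * gen b) (gen a) w, d \in a :: w &
                    forall c, c \in a :: w -> jle d c].
Proof.
move=> ss; have [a [w sE]] := ip_word s.
have [d dw dmin] := jle_minimal a w; exists a, w, d; split=> // c cw.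
pose T := option (nat * bool) -> option (nat * bool).
have [F Fgen FM] := @ip_lift _ _ _ hS T (fun f g z => g (f z)) id
  (fun b z => alternate d z b) (fun _ _ _ => erefl) (fun=> erefl) (fun=> erefl)
  (fun a b ab => funext (fun z => alternate_basic d z ab)).
have Fs z : F s z = foldl (alternate d) z (a :: w).
  rewrite sE; elim/last_ind: w {sE dw dmin cw} => [|w b IHw] /=.
    by rewrite Fgen.
  by rewrite -cats1 !foldl_cat /= FM Fgen IHw.
have [n [q [run1 _ _]]] := alternate_run 0 true dmin.
have [m [q' [run2 _ same]]] := alternate_run n q dmin.
have := Fs (Some (0, true)); rewrite -ss FM !Fs run1 run2 => -[mn _].
have [_ {}same] := same mn.
have qd := same d dw erefl; rewrite jle_refl // in qd.
have := same c cw; have := dmin c cw; rewrite qd.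
by case: (jle c d) (jle d c) => [] [] //= => [/(_ isT)|_ /(_ erefl)].
Qed.

End Idempotents.
(** * Maps out of a free group into a monoid inside a semigroup *)

Section FreeGroupLift.
Variables (X : choiceType) (S : semigroupType) (E : S) (f : X * bool -> S).
Hypotheses (EE : E * E = E) (Ef : forall l, E * f l = f l)
  (fE : forall l, f l * E = f l)
  (fV : forall x b, f (x, b) * f (x, ~~ b) = E).

Definition sw_eval (w : signed_word X) : S := foldr (fun l s => f l * s) E w.

Definition fg_lift (a : free_group X) : S :=
  sw_eval (repr (a : presented (@cancel_letters X))).

Definition fg_gen (x : X) : free_group X :=
  presented_pi (@cancel_letters X) ([:: (x, true)] : signed_word X).

Lemma sw_evalE w : E * sw_eval w = sw_eval w.
Proof. by case: w => [|l w] //=; rewrite mulgA Ef. Qed.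

Lemma sw_evalM (u v : signed_word X) :
  sw_eval (u * v) = sw_eval u * sw_eval v.
Proof.
rewrite -[u * v]/(u ++ v).
by elim: u => [|l u IHu] /=; rewrite ?sw_evalE // IHu mulgA.
Qed.

Lemma fg_lift_pi (w : signed_word X) :
  fg_lift (presented_pi (@cancel_letters X) w) = sw_eval w.
Proof.
have cong (u v : signed_word X) : cong_gen (@cancel_letters X) u v ->
    sw_eval u = sw_eval v.
  elim=> {u v} //.
  - by move=> u v [x [b [-> ->]]] /=; rewrite fE fV.
  - by move=> u v w' _ -> _ ->.
  - by move=> u u' v v' _ Hu _ Hv; rewrite !sw_evalM Hu Hv.
by apply: cong; apply/presented_piP; rewrite presented_piK.
Qed.

Lemma fg_liftM (a b : free_group X) : fg_lift (a * b) = fg_lift a * fg_lift b.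
Proof.
rewrite -(presented_piK a) -(presented_piK b).
rewrite [X in fg_lift X](_ : _ = presented_pi _ (repr a * repr b : signed_word X)).
  by rewrite !fg_lift_pi sw_evalM.
exact: presented_piM.
Qed.

Lemma fg_lift1 : fg_lift 1 = E.
Proof. exact: fg_lift_pi. Qed.

Lemma fg_lift_gen x : fg_lift (fg_gen x) = f (x, true).
Proof. by rewrite fg_lift_pi /= fE. Qed.

Lemma fg_genV x : (fg_gen x)^-1 =
  presented_pi (@cancel_letters X) ([:: (x, false)] : signed_word X).
Proof.
apply: mulg1_eq; rewrite [LHS]presented_piM; apply/presented_piP.
by apply: cong_gen_base; exists x, true.
Qed.

(** Induction on a word, phrased so that the letters [x] and [x^-1] appear as
    group elements. *)
Lemma fg_ind (P : free_group X -> Prop) :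
  P 1 -> (forall x a, P a -> P (fg_gen x * a)) ->
  (forall x a, P a -> P ((fg_gen x)^-1 * a)) -> forall a, P a.
Proof.
move=> P1 Pgen PgenV a; rewrite -(presented_piK a).
elim: (repr _ : signed_word X) => [|[x b] w IHw]; first exact: P1.
suff -> : presented_pi (@cancel_letters X) ((x, b) :: w : signed_word X) =
    (if b then fg_gen x else (fg_gen x)^-1) *
      presented_pi (@cancel_letters X) (w : signed_word X).
  by case: b; [exact: Pgen | exact: PgenV].
by case: b; rewrite ?fg_genV [RHS]presented_piM.
Qed.

End FreeGroupLift.
(** * The D-class of an idempotent of a right seminormal band *)

Section RightSeminormal.
Variables (B S : semigroupType) (gen : B -> S).
Hypotheses (hB : is_band B) (hR : right_seminormal B).
Hypothesis hS : idempotent_presentation gen.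
Variable e : B.
Local Notation E := (gen e).

(** [inL] and [inR] are the L-class and the R-class of [e]. They serve as the
    row and column indices of its rectangular D-class. *)
Definition inL (x : B) : Prop := x * e = x /\ e * x = e.
Definition inR (x : B) : Prop := e * x = x /\ x * e = e.

Lemma inL_e : inL e. Proof. by split; apply: hB. Qed.
Lemma inR_e : inR e. Proof. by split; apply: hB. Qed.

Lemma inL_jle i : inL i -> jle e i && jle i e.
Proof. by case=> ie ei; rewrite /jle ie ei !hB !eqxx. Qed.

Lemma inR_jle j : inR j -> jle e j && jle j e.
Proof. by case=> ej je; rewrite /jle ej je ej !eqxx. Qed.

Lemma inRL j i : inR j -> inL i -> j * i = e.
Proof.
move=> Jj Ii; have : jle e (j * i).
  by rewrite jle_mul //; case/andP: (inR_jle Jj) => ->; case/andP: (inL_jle Ii).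
case: Jj Ii => [ej _] [ie _] /eqP.
by rewrite mulgA ej -mulgA ie.
Qed.

(** The only use of right seminormality: [b i e = b e (b i e)], and the right
    side collapses to [b e] because [e b i = (e i) b i = e (i b i) = e]. *)
Lemma inL_act b i : jle e b -> inL i -> b * i = b * e.
Proof.
move=> eb Ii; have /andP[_ ie] := inL_jle Ii.
have /eqP ibi := jle_trans hB ie eb; case: Ii => {}ie ei.
have := hR b i e; rewrite -(mulgA b i e) ie => ->.
by rewrite -!mulgA ie -[in LHS]ei -!mulgA (mulgA i) ibi ei.
Qed.

Lemma inLM b i : jle e b -> inL i -> inL (b * i).
Proof.
move=> eb Ii; rewrite inL_act //; split; first by rewrite -mulgA hB.
by move/eqP: eb; rewrite mulgA.
Qed.

Lemma inRM b j : jle e b -> inR j -> inR (j * b).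
Proof.
move=> eb Jj; have /andP[_ je] := inR_jle Jj.
have /eqP jbj := jle_trans hB je eb; case: Jj => ej {}je.
by split; [rewrite mulgA ej | rewrite -je mulgA jbj je].
Qed.

(** ** Products of generators *)

Lemma genMl a b : a * b = a -> gen a * gen b = gen a.
Proof. by move=> ab; rewrite (ip_basic hS) ?ab //; exists (a * b); split; left. Qed.

Lemma genMr a b : a * b = b -> gen a * gen b = gen b.
Proof.
by move=> ab; rewrite (ip_basic hS) ?ab //; exists (a * b); split; [left|right].
Qed.

Lemma gen_basic_r a b : b * a = b -> gen a * gen b = gen (a * b).
Proof. by move=> ba; apply: (ip_basic hS); exists (b * a); split; right. Qed.

Lemma gen_basic_l a b : b * a = a -> gen a * gen b = gen (a * b).
Proof. by move=> ba; apply: (ip_basic hS); exists (b * a); split; [right|left]. Qed.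

(** Although [x] and [b] need not form a basic pair, [x] and [b x] are
    L-related, so that [b x] can be inserted between them and then forms a
    basic pair with [b]. *)
Lemma genM_conjr x b : jle x b -> gen x * gen b = gen x * gen (b * x * b).
Proof.
move=> /eqP xb; have xbx : x * (b * x) = x by rewrite mulgA.
have bxx : b * x * x = b * x by rewrite -mulgA hB.
rewrite -[in LHS](genMl xbx) -mulgA (@gen_basic_l (b * x) b) //.
by rewrite mulgA hB.
Qed.

Lemma genM_conjl x b : jle x b -> gen b * gen x = gen (b * x * b) * gen x.
Proof.
move=> /eqP xb.
rewrite -[in LHS](genMr xb) mulgA (@gen_basic_r b (x * b)) ?mulgA //.
by rewrite -mulgA hB.
Qed.

Lemma conj_D x b : jle e b -> jle e x -> jle x e ->
  jle e (b * x * b) && jle (b * x * b) e.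
Proof.
move=> eb ex xe; rewrite !jle_mul // eb ex /=.
apply: (jle_trans hB) xe.
exact: (jle_trans hB) (jle_mull hB _ _) (jle_mulr hB _ _).
Qed.

Lemma genER j : inR j -> E * gen j = gen j.
Proof. by case=> ej _; rewrite genMr. Qed.
Lemma genRE j : inR j -> gen j * E = E.
Proof. by case=> _ je; rewrite genMr. Qed.
Lemma genLE i : inL i -> gen i * E = gen i.
Proof. by case=> ie _; rewrite genMl. Qed.
Lemma genEL i : inL i -> E * gen i = E.
Proof. by case=> _ ei; rewrite genMl. Qed.
Lemma genEE : E * E = E.
Proof. by rewrite genMl // hB. Qed.

Section Rect.
Variables (i j : B).
Hypotheses (Ii : inL i) (Jj : inR j).

Lemma genL_rect : gen i * gen (i * j) = gen (i * j).
Proof. by rewrite genMr // mulgA hB. Qed.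
Lemma gen_rectR : gen (i * j) * gen j = gen (i * j).
Proof. by rewrite genMl // -mulgA hB. Qed.
Lemma genR_rect : gen j * gen (i * j) = gen j.
Proof. by rewrite genMl // mulgA (inRL Jj Ii); case: Jj. Qed.
Lemma gen_rectL : gen (i * j) * gen i = gen i.
Proof. by rewrite genMr // -mulgA (inRL Jj Ii); case: Ii. Qed.

(** The sandwich entry of column [j] and row [i] is invertible: its inverse is
    the generator [i j], brought into the H-class of [e]. *)
Lemma sandwichV : gen j * gen i * (E * gen (i * j) * E) = E.
Proof.
rewrite !mulgA -(mulgA (gen j)) genLE // -(mulgA (gen j)) genL_rect.
by rewrite genR_rect genRE.
Qed.

Lemma sandwichVl : E * gen (i * j) * E * (gen j * gen i) = E.
Proof.
have -> : E * gen (i * j) * E * (gen j * gen i) =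
          E * (gen (i * j) * (E * gen j) * gen i) by rewrite !mulgA.
by rewrite genER // gen_rectR gen_rectL genEL.
Qed.

Lemma gen_rect : gen i * (E * gen (i * j) * E) * gen j = gen (i * j).
Proof.
have -> : gen i * (E * gen (i * j) * E) * gen j =
          gen i * E * gen (i * j) * (E * gen j) by rewrite !mulgA.
by rewrite genLE // genER // genL_rect gen_rectR.
Qed.

End Rect.

(** ** Linked columns *)

(** Two columns that an element above [e] fixes are the columns of a singular
    square for every choice of a row. *)
Definition linked (j l : B) : Prop :=
  [/\ inR j, inR l & exists b, [/\ jle e b, j * b = j & l * b = l]].

Definition conn := clos_refl_sym_trans B linked.

(** Inserting [b] after [gen l] turns [gen (x j)] into [gen (b x j)], which
    does not depend on [x] because [b] acts on rows as a constant. Hence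
    [gen l * gen (i j) = gen l * gen (e j) = gen j]; multiply by [gen i]. *)
Lemma linked_sandwich j l i : linked j l -> inL i ->
  gen j * gen i = gen l * gen i.
Proof.
move=> [Jj Jl [b [eb jb lb]]] Ii.
have lx x : inL x -> gen l * gen (x * j) = gen l * gen (b * e * j).
  move=> Ix; rewrite -{1}(genMl lb) -mulgA (@gen_basic_r b (x * j)); last first.
    by rewrite -mulgA jb.
  by rewrite mulgA (inL_act eb Ix).
have <- : gen l * gen (i * j) = gen j.
  rewrite lx // -(lx e inL_e) genMr; first by case: Jj => ->.
  case: Jj Jl => [ej je] [el le].
  by rewrite !mulgA le.
by rewrite -mulgA gen_rectL.
Qed.

Lemma conn_inR j l : conn j l -> inR j <-> inR l.
Proof.
elim=> {j l} [j l []|j|j l _ []|j k l _ [jk kj] _ [kl lk]]; split; auto.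
Qed.

Lemma conn_sandwich j l i : conn j l -> inL i -> gen j * gen i = gen l * gen i.
Proof.
move=> + Ii; elim=> {j l} // [j l jl|j k l _ -> _ ->] //.
exact: linked_sandwich.
Qed.

(** A canonical column in the component of [j]: the choice operator depends
    only on the extent of the predicate. *)
Definition conn_repr (j : B) : B := choose (fun l => `[< conn j l >]) j.

Lemma conn_to_repr j : conn j (conn_repr j).
Proof.
by apply/asboolP; apply: (@chooseP _ (fun l => `[< conn j l >]));
   apply/asboolP; apply: rst_refl.
Qed.

Lemma conn_repr_eq j l : conn j l -> conn_repr j = conn_repr l.
Proof.
move=> jl; rewrite /conn_repr (@eq_choose _ _ (fun k => `[< conn l k >])) => [|k].
  by apply: choose_id; apply/asboolP; [apply: rst_sym | apply: rst_refl].
apply/asboolP/asboolP; apply: rst_trans => //; exact: rst_sym.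
Qed.

(** ** The free group *)

(** A pair stands for a component of columns, through its canonical
    representative, and a row; the row and the component of [e] are left out
    because their sandwich entries are trivial. *)
Definition basis : Type :=
  {x : B * B | `[< [/\ inR x.1, inL x.2, conn_repr x.1 = x.1, ~ conn e x.1
                     & x.2 <> e] >]}.

(** The normalized sandwich matrix over the free group: entries in the row of
    [e] or in the component of the column [e] are trivial, and all other
    entries are free generators, shared by the columns of a component. *)
Definition sandwich (j i : B) : free_group basis :=
  if insub (conn_repr j, i) is Some x then fg_gen (x : basis) else 1.

Lemma sandwich_conn j l i : conn j l -> sandwich j i = sandwich l i.
Proof. by move=> jl; rewrite /sandwich (conn_repr_eq jl). Qed.

Lemma sandwich_jE j : sandwich j e = 1.
Proof. by rewrite /sandwich; case: insubP => //= x /asboolP[]. Qed.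

Lemma sandwich_Ei i : sandwich e i = 1.
Proof.
rewrite /sandwich; case: insubP => //= x /asboolP[_ _ _ ne].
by case: ne; exact: conn_to_repr.
Qed.

Lemma sandwich_basis (x : basis) : sandwich (val x).1 (val x).2 = fg_gen x.
Proof.
have /asboolP[_ _ rx _ _] := valP x.
by rewrite /sandwich rx -surjective_pairing valK.
Qed.

Definition letter_val (l : basis * bool) : S :=
  let j := (val l.1).1 in let i := (val l.1).2 in
  if l.2 then gen j * gen i else E * gen (i * j) * E.

Lemma E_letter_val l : E * letter_val l = letter_val l.
Proof.
rewrite /letter_val; case: l => x [] /=; rewrite !mulgA ?genEE //.
by have /asboolP[Jj _ _ _ _] := valP x; rewrite genER.
Qed.

Lemma letter_valE l : letter_val l * E = letter_val l.
Proof.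
rewrite /letter_val; case: l => x [] /=; rewrite -!mulgA ?genEE //.
by have /asboolP[_ Ii _ _ _] := valP x; rewrite genLE.
Qed.

Lemma letter_valV x b : letter_val (x, b) * letter_val (x, ~~ b) = E.
Proof.
have /asboolP[Jj Ii _ _ _] := valP x.
by case: b; rewrite /letter_val /= ?sandwichV ?sandwichVl.
Qed.

Definition fg_eval : free_group basis -> S := fg_lift E letter_val.

Lemma fg_evalM a b : fg_eval (a * b) = fg_eval a * fg_eval b.
Proof. exact: fg_liftM genEE E_letter_val letter_valE letter_valV a b. Qed.

Lemma fg_eval1 : fg_eval 1 = E.
Proof. exact: fg_lift1 genEE E_letter_val letter_valE letter_valV. Qed.

Lemma fg_evalE a : fg_eval a * E = fg_eval a.
Proof. by rewrite -fg_eval1 -fg_evalM mulg1. Qed.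

Lemma fg_evalEl a : E * fg_eval a = fg_eval a.
Proof. by rewrite -fg_eval1 -fg_evalM mul1g. Qed.

Lemma fg_eval_gen x : fg_eval (fg_gen x) = gen (val x).1 * gen (val x).2.
Proof. exact: fg_lift_gen genEE E_letter_val letter_valE letter_valV x. Qed.

(** The sandwich matrix over the free group maps to the one in [S]. The
    entries that are trivial by normalization are [gen j * E] and, up to
    connectedness, [E * gen i]. *)
Lemma fg_eval_sandwich j i : inR j -> inL i -> fg_eval (sandwich j i) = gen j * gen i.
Proof.
move=> Jj Ii; have cj := conn_to_repr j.
rewrite /sandwich; case: insubP => [x _ xE|/asboolP nvalid].
  by rewrite fg_eval_gen xE /= (conn_sandwich cj Ii).
rewrite fg_eval1; have [->|ie] := pselect (i = e); first by rewrite genRE.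
have [ce|nce] := pselect (conn e (conn_repr j)).
  by rewrite (conn_sandwich cj) // -(conn_sandwich ce) // genEL.
case: nvalid; split=> //=; first exact/(conn_inR cj).
by rewrite -(conn_repr_eq cj).
Qed.

Lemma fg_eval_sandwichV j i : inR j -> inL i ->
  fg_eval (sandwich j i)^-1 = E * gen (i * j) * E.
Proof.
move=> Jj Ii; rewrite -[LHS]fg_evalE -[in LHS](sandwichV Ii Jj) -fg_eval_sandwich //.
by rewrite (mulgA (fg_eval _)) -fg_evalM mulVg fg_eval1 !mulgA genEE.
Qed.

(** ** Injectivity *)

(** Right multiplication by [gen b] on the R-class of row [e] in the Rees matrix
    semigroup with the above sandwich matrix; a pair [(g, j)] stands for the
    element with middle part [g] and column [j]. As [gen x * gen b = gen x * gen (b x b)], an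
    element [b] above [e] multiplies like the element of the D-class with row
    [b e] and column [j b]. [None] is the zero that is reached by elements not
    above [e]. *)
Definition rees_act (st : option (free_group basis * B)) (b : B) :=
  if st is Some (g, j) then
    if `[< jle e b /\ inR j >] then
      Some (g * sandwich j (b * e) * (sandwich (j * b) (b * e))^-1, j * b)
    else None
  else None.

(** For a basic pair either both elements have the same constant row, or the
    column does not move under the second one, or both columns [j a] and
    [j a b] are fixed by [a] and hence are linked. *)
Lemma rees_act_basic st a b :
  basic_pair a b -> rees_act (rees_act st a) b = rees_act st (a * b).
Proof.
case: st => [[g j]|//] ab /=.
have -> : `[< jle e (a * b) /\ inR j >] =
    `[< jle e a /\ inR j >] && `[< jle e b /\ inR j >].
  apply/asboolP/andP; rewrite jle_mul // => -[].
    by move=> /andP[-> ->] Jj; split; apply/asboolP.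
  by move=> /asboolP[-> Jj] /asboolP[-> _].
case: (asboolP (_ /\ _)) => [[ea Jj]|] //=.
have Jja := inRM ea Jj.
case: (asboolP (_ /\ _)) => [[eb _]|nb]; last first.
  by case: asboolP => // -[eb _]; case: nb.
rewrite asboolT //= (mulgA j); congr (Some (_, _)).
have La : inL (a * e) by exact: inLM inL_e.
have Lb : inL (b * e) by exact: inLM inL_e.
have -> : a * b * e = a * e by rewrite -mulgA inL_act.
suff key : sandwich (j * a) (b * e) * (sandwich (j * a * b) (b * e))^-1 =
           sandwich (j * a) (a * e) * (sandwich (j * a * b) (a * e))^-1.
  rewrite -(mulgA _ (sandwich (j * a) (b * e)) _) key.
  by rewrite mulgA mulgVK.
case: ab => _ [[->|->] [ab|ab]].
- by rewrite -mulgA ab !mulgV.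
- have <- : a * e = b * e by rewrite -ab -mulgA inL_act.
  by [].
- have -> : b * e = a * e by rewrite -[in RHS]ab -mulgA inL_act.
  by [].
- have c : conn (j * a) (j * a * b).
    apply: rst_step; split=> //; first exact: inRM.
    by exists a; rewrite -!mulgA hB ab.
  by rewrite !(sandwich_conn _ c) !mulgV.
Qed.

(** Acting on [(1, e)], the image of a group element [a] recovers [a] as the
    first component. *)
Lemma fg_eval_inj : injective fg_eval.
Proof.
pose T := option (free_group basis * B) -> option (free_group basis * B).
(* Acting on the right, the product of transformations is composition with
   the left factor applied first. *)
have [A Agen AM] := @ip_lift _ _ _ hS T (fun f g z => g (f z)) id
  (fun b z => rees_act z b) (fun _ _ _ => erefl) (fun=> erefl) (fun=> erefl)
  (fun a b ab => funext (fun z => rees_act_basic z ab)).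
have Ax x h : A (gen (val x).1 * gen (val x).2) (Some (h, e)) =
    Some (h * fg_gen x, e).
  have /asboolP[Jj Ii _ _ _] := valP x; rewrite -sandwich_basis.
  move: (val x).1 (val x).2 Jj Ii => j i Jj Ii.
  have [[ej je] [ie ei]] := (Jj, Ii).
  rewrite AM !Agen /= asboolT; last by split; [case/andP: (inR_jle Jj)|exact: inR_e].
  rewrite ej je /= asboolT; last by split=> //; case/andP: (inL_jle Ii).
  by rewrite ie inRL // !sandwich_Ei sandwich_jE invg1 !mulg1.
have AE h : A E (Some (h, e)) = Some (h, e).
  rewrite Agen /= asboolT; last by split; [exact: jle_refl|exact: inR_e].
  by rewrite hB mulgK.
have AV x h : A (fg_eval (fg_gen x)^-1) (Some (h, e)) = Some (h * (fg_gen x)^-1, e).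
  rewrite -[in LHS](mulgVK (fg_gen x) h) -Ax -fg_eval_gen.
  rewrite -[LHS]/((fun z => A (fg_eval (fg_gen x)^-1) (A (fg_eval (fg_gen x)) z)) _).
  by rewrite -AM -fg_evalM mulgV fg_eval1 AE.
have Aphi a h : A (fg_eval a) (Some (h, e)) = Some (h * a, e).
  elim/fg_ind: a h => [|x a IHa|x a IHa] h; first by rewrite fg_eval1 mulg1 AE.
    by rewrite fg_evalM fg_eval_gen AM Ax IHa mulgA.
  by rewrite fg_evalM AM AV IHa mulgA.
move=> a b /(congr1 (fun s => A s (Some (1, e)))).
by rewrite !Aphi !mul1g => -[].
Qed.

(** ** Normal forms *)

Definition normal_form (s : S) : Prop :=
  exists i a j, [/\ inL i, inR j & s = gen i * fg_eval a * gen j].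

Lemma normal_mid a b i j : inR j -> inL i ->
  fg_eval a * gen j * (gen i * fg_eval b) = fg_eval (a * sandwich j i * b).
Proof. by move=> Jj Ii; rewrite !fg_evalM fg_eval_sandwich // !mulgA. Qed.

Lemma normalM s t : normal_form s -> normal_form t -> normal_form (s * t).
Proof.
move=> [i [a [j [Ii Jj ->]]]] [k [b [l [Ik Jl ->]]]].
exists i, (a * sandwich j k * b), l; split=> //.
by rewrite -normal_mid // !mulgA.
Qed.

Lemma normal_gen x : jle e x -> jle x e -> normal_form (gen x).
Proof.
move=> ex xe; have Ix := inLM ex inL_e; have Jx := inRM ex inR_e.
exists (x * e), (sandwich (e * x) (x * e))^-1, (e * x); split=> //.
rewrite fg_eval_sandwichV // gen_rect //; congr gen.
by move/eqP: xe => {1}<-; rewrite !mulgA -(mulgA x e e) hB.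
Qed.

(** Membership in the subsemigroup generated by the [gen b] with [b] above
    [e], in the form of its induction principle. *)
Definition above (s : S) : Prop :=
  forall P : S -> Prop, (forall b, jle e b -> P (gen b)) ->
    (forall s t, P s -> P t -> P (s * t)) -> P s.

Lemma normal_mulr s t : normal_form s -> above t -> normal_form (s * t).
Proof.
move=> + /(_ (fun t => forall s, normal_form s -> normal_form (s * t))) At; apply: At.
  move=> b eb {}s [i [a [j [Ii Jj ->]]]].
  have /andP[ej je] := inR_jle Jj.
  rewrite -mulgA genM_conjr; last exact: (jle_trans hB je eb).
  rewrite mulgA; have /andP[? ?] := conj_D eb ej je.
  by apply: normalM; [exists i, a, j | exact: normal_gen].
by move=> u v Hu Hv {}s Ns; rewrite mulgA; apply: Hv; apply: Hu.
Qed.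

Lemma normal_mull s t : normal_form s -> above t -> normal_form (t * s).
Proof.
move=> + /(_ (fun t => forall s, normal_form s -> normal_form (t * s))) At; apply: At.
  move=> b eb {}s [i [a [j [Ii Jj ->]]]].
  have /andP[ei ie] := inL_jle Ii.
  rewrite -(mulgA (gen i)) (mulgA (gen b)) genM_conjl; last exact: (jle_trans hB ie eb).
  rewrite -(mulgA (gen _)); have /andP[? ?] := conj_D eb ei ie.
  apply: normalM; first exact: normal_gen.
  by exists i, a, j; split=> //; rewrite mulgA.
by move=> u v Hu Hv {}s Ns; rewrite -mulgA; apply: Hu; apply: Hv.
Qed.

Lemma above_word a w : (forall c, c \in a :: w -> jle e c) ->
  above (foldl (fun t b => t * gen b) (gen a) w).
Proof.
elim/last_ind: w => [|w b IHw] Hw P Pgen PM.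
  by apply: Pgen; apply: Hw; rewrite mem_head.
rewrite -cats1 foldl_cat /=; apply: (PM); last first.
  by apply: Pgen; apply: Hw; rewrite -rcons_cons mem_rcons mem_head.
apply: IHw => // c cw; apply: Hw.
by rewrite -rcons_cons mem_rcons in_cons cw orbT.
Qed.

Lemma normal_word a w : e \in a :: w -> (forall c, c \in a :: w -> jle e c) ->
  normal_form (foldl (fun t b => t * gen b) (gen a) w).
Proof.
have ee : normal_form E by apply: normal_gen; apply: jle_refl.
elim/last_ind: w => [|w b IHw] ew Hw.
  by move: ew; rewrite inE => /eqP <-.
rewrite -cats1 foldl_cat /=.
have Hw' c : c \in a :: w -> jle e c.
  by move=> cw; apply: Hw; rewrite -rcons_cons mem_rcons in_cons cw orbT.
have eb : jle e b by apply: Hw; rewrite -rcons_cons mem_rcons mem_head.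
move: ew; rewrite -rcons_cons mem_rcons in_cons => /predU1P[<-|ew].
  by apply: normal_mull => //; exact: above_word.
by apply: normal_mulr; [exact: IHw | move=> P Pgen _; exact: Pgen].
Qed.

(** The map to booleans that sends [gen b] to [jle e b] is multiplicative by
    [jle_mul], and it detects [above]. *)
Lemma above_factor s t : above (s * t) -> above s.
Proof.
have [F Fgen FM] := @ip_lift _ _ _ hS bool andb true (fun b => jle e b)
  andbA andTb andbT (fun a b _ => esym (jle_mul hB e a b)).
have Fabove u : F u -> above u.
  elim/(ip_ind hS): u => [a|u v IHu IHv].
    by rewrite Fgen => ea P Pgen _; exact: Pgen.
  rewrite FM => /andP[/IHu Au /IHv Av] P Pgen PM.
  by apply: (PM); [exact: Au | exact: Av].
move=> /(_ (fun u => F u)) Fst; apply: Fabove.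
have : F (s * t) by apply: Fst => [b|u v]; rewrite ?Fgen // FM => -> ->.
by rewrite FM => /andP[].
Qed.

(** ** The maximal subgroup *)

(** With [f] in row [i] and column [j], the H-class of [f] is the set of all
    [gen i * h * gen j]; multiplication there inserts the sandwich entry [p]
    between the middle parts, which the factor [p^-1] in [psi] cancels. The
    image of [psi] is a subgroup that contains [G], hence equals [G]. *)
Lemma maximal_subgroup_free (G : set S) f :
  is_maximal_subgroup G -> G f -> (forall x, G x -> f * x = x /\ x * f = x) ->
  (forall x, G x -> exists y, x * y = f) ->
  normal_form f -> above f -> is_free_group G.
Proof.
move=> [sG maxG] Gf fid finv Nf Af.
have [i [a [j [Ii Jj fE]]]] := Nf.
pose p := sandwich j i.
pose psi (g : free_group basis) : S := gen i * fg_eval (g * p^-1) * gen j.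
have psiM : {morph psi : x y / x * y}.
  move=> x y; rewrite /psi.
  have -> : gen i * fg_eval (x * p^-1) * gen j * (gen i * fg_eval (y * p^-1) * gen j) =
    gen i * (fg_eval (x * p^-1) * gen j * (gen i * fg_eval (y * p^-1))) * gen j.
    by rewrite !mulgA.
  by rewrite normal_mid // -/p mulgVK mulgA.
have psi_inj : injective psi.
  move=> x y /(congr1 (fun s => E * s * E)) psixy.
  have EpsiE z : E * psi z * E = fg_eval (z * p^-1).
    rewrite /psi !mulgA genEL // -(mulgA _ _ E) genRE // -mulgA fg_evalE.
    by rewrite fg_evalEl.
  move: psixy; rewrite !EpsiE => /fg_eval_inj; exact: mulIg.
(* Sandwiching [x = f x f] between [f] on both sides moves it to row [i] and
   column [j], whatever row and column its normal form has. *)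
have Gpsi : (G `<=` range psi)%classic.
  move=> x Gx; have [fx xf] := fid x Gx.
  have Ax : above x.
    by have [y xy] := finv x Gx; apply: (@above_factor x y); rewrite xy.
  have [k [b [l [Ik Jl xE]]]] : normal_form x.
    by rewrite -fx; exact: normal_mulr.
  exists (a * sandwich j k * b * sandwich l i * a * p) => //.
  rewrite /psi mulgK -xf -fx xE fE -normal_mid // -normal_mid //.
  by rewrite !mulgA.
exists basis.
pose psi_mul := isMultiplicative.Build _ _ psi psiM.
pose Psi : {multiplicative free_group basis -> S} := HB.pack psi psi_mul.
exists Psi; split=> //; apply: maxG => //.
split.
  by move=> _ _ [x _ <-] [y _ <-]; exists (x * y) => //; rewrite psiM.
exists (psi 1); first by exists 1.
move=> _ [x _ <-]; rewrite -!psiM mul1g mulg1; split=> //; split=> //.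
by exists (psi x^-1); [exists x^-1 | rewrite -!psiM mulgV mulVg].
Qed.

End RightSeminormal.

(** * Right seminormal bands *)

Lemma right_seminormal_free (B S : semigroupType) (gen : B -> S) (G : set S) :
  is_band B -> right_seminormal B -> idempotent_presentation gen ->
  is_maximal_subgroup G -> is_free_group G.
Proof.
move=> hB hR hS hG; have [[_ [f Gf fG]] _] := hG.
have ff : f * f = f by case: (fG f Gf).
have [a [w [e [fE ew emin]]]] := idempotent_bottom hB hS ff.
apply: (maximal_subgroup_free hB hR hS hG Gf) => [x|x||].
- by case/fG=> ? [].
- by case/fG=> _ [_ [y _ [xy _]]]; exists y.
- by rewrite fE; exact: normal_word ew emin.
- by rewrite fE; exact: above_word emin.
Qed.

(** * Opposite semigroups *)

Definition opposite (S : Type) : Type := S.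


Section Opposite.
Variable S : semigroupType.

Definition opp_mul (x y : opposite S) : opposite S := (y : S) * (x : S).

Lemma opp_mulA : associative opp_mul.
Proof. by move=> x y z; rewrite /opp_mul mulgA. Qed.

HB.instance Definition _ := Choice.on (opposite S).
HB.instance Definition _ := isSemigroup.Build (opposite S) opp_mulA.

Lemma opp_mulE (x y : opposite S) : x * y = (y : S) * (x : S) :> S.
Proof. by []. Qed.

Lemma opp_subgroup (G : set S) :
  is_subgroup G <-> is_subgroup (G : set (opposite S)).
Proof.
split=> -[GM [e Ge He]]; split=> [x y Gx Gy|]; do ?[exact: GM];
  exists e => // x /He[ex [xe [y Gy [xy yx]]]]; split=> //; split=> //;
  by exists y.
Qed.

Lemma opp_maximal_subgroup (G : set S) :
  is_maximal_subgroup G -> is_maximal_subgroup (G : set (opposite S)).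
Proof.
by case=> /opp_subgroup sG maxG; split=> // H /opp_subgroup; exact: maxG.
Qed.

(** Inversion turns the free group into its own opposite. *)
Lemma opp_free_group (G : set S) :
  is_free_group (G : set (opposite S)) -> is_free_group G.
Proof.
case=> X [phi [phi_inj phiG]]; exists X.
pose psi (a : free_group X) : S := phi a^-1.
have psiM : {morph psi : x y / x * y}.
  by move=> x y; rewrite /psi invgM gmulfM.
pose psi_mul := isMultiplicative.Build _ _ psi psiM.
pose Psi : {multiplicative free_group X -> S} := HB.pack psi psi_mul.
exists Psi; split; first by move=> x y /phi_inj /invg_inj.
rewrite -phiG; apply/seteqP; split=> _ [x _ <-]; exists x^-1 => //=.
by rewrite /psi invgK.
Qed.

End Opposite.

Lemma opp_basic (B : semigroupType) (a b : B) :
  basic_pair (a : opposite B) (b : opposite B) <-> basic_pair b a.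
Proof.
by split=> -[x [[xE|xE] [yE|yE]]]; exists x; split;
  do ?[by left | by right].
Qed.

Lemma opp_presentation (B S : semigroupType) (gen : B -> S) :
  idempotent_presentation gen ->
  idempotent_presentation (gen : opposite B -> opposite S).
Proof.
move=> [gbasic gind glift]; split.
- by move=> a b /opp_basic /gbasic.
- move=> P Pgen PM; apply: gind => // s t Ps Pt; exact: (PM t s).
- move=> T mul one f mulA mul1 mulr1 fbasic.
  have [|a b /opp_basic ab|F Fgen FM] := glift T (fun x y => mul y x) one f _ mulr1 mul1.
  + by move=> x y z; rewrite mulA.
  + exact: fbasic.
  by exists F => // s t; exact: (FM t s).
Qed.

Theorem proposition2 (B : semigroupType) (hB : is_band B)
    (hsn : left_seminormal B \/ right_seminormal B)
    (G : set (IG B)) (hG : is_maximal_subgroup G) :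
  is_free_group G.
Proof.
case: hsn => [hL|hR].
  apply: opp_free_group.
  apply: (right_seminormal_free (B := opposite B) _ _
    (opp_presentation (IG_presentation hB)) (opp_maximal_subgroup hG)).
    exact: hB.
  by move=> t u v; rewrite !opp_mulE !mulgA; exact: hL.
exact: right_seminormal_free hB hR (IG_presentation hB) hG.
Qed.
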